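(* If $G$ is a subcubic graph with $\mathrm{mad}(G)<\frac{30}{11}$, then $\chi_p(D(G))\le 5$.
   Context: Graphs are finite and simple. A graph is subcubic if its maximum degree is at most $3$. The maximum average degree of $G$ is $\mathrm{mad}(G)=\max\{\frac{2|E(H)|}{|V(H)|} : H\subseteq G\}$, the maximum being over subgraphs $H$ with at least one vertex. $D(G)$ denotes the graph obtained from $G$ by subdividing every edge (once). For a non-decreasing sequence of positive integers $S=(s_1,\dots,s_k)$, a packing $S$-coloring of a graph is a partition of its vertex set into (possibly empty) sets $V_1,\dots,V_k$ such that for each $1\le i\le k$ the distance between any two distinct $x,y\in V_i$ is at least $s_i+1$ (vertices in different components are at infinite distance). The packing chromatic number $\chi_p(H)$ of a graph $H$ is the smallest $k$ such that $H$ has a packing $(1,2,\dots,k)$-coloring. *)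

(* Defs.v *)
From mathcomp Require Import all_boot all_order all_algebra.

Set Implicit Arguments.
Unset Strict Implicit.
Unset Printing Implicit Defensive.

Import Order.TTheory GRing.Theory Num.Theory.

Record sgraph := SGraph {
  vertex :> finType;
  adj : rel vertex;
  adj_sym : symmetric adj;
  adj_irr : irreflexive adj }.

Arguments adj {_}.

Definition edges (G : sgraph) : {set {set G}} :=
  [set f : {set G} | [exists x, exists y, adj x y && (f == [set x; y])]].

Definition degree (G : sgraph) (x : G) : nat := #|[set y | adj x y]|.

Definition max_degree (G : sgraph) : nat := \max_(x : G) degree x.

Definition subcubic (G : sgraph) : bool := max_degree G <= 3.

(* A pair (W, F) of a set of vertices and a set of edges. *)
Definition is_subgraph (G : sgraph) (H : {set G} * {set {set G}}) : bool :=
  (H.2 \subset edges G) && [forall f in H.2, f \subset H.1].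

(* All the quotients are nonnegative, so the default value 0 only matters when
   G has no vertex, in which case mad G = 0. *)
Definition mad (G : sgraph) : rat :=
  (\big[Num.max/0]_(H : {set G} * {set {set G}}
                      | is_subgraph H && (H.1 != set0))
     (2 * #|H.2|%:R / #|H.1|%:R))%R.

Definition subdiv_vertex (G : sgraph) : finType :=
  (G + {f : {set G} | f \in edges G})%type.

Definition subdiv_adj (G : sgraph) : rel (subdiv_vertex G) :=
  fun u v => match u, v with
  | inl x, inr f => x \in val f
  | inr f, inl x => x \in val f
  | _, _ => false
  end.

Lemma subdiv_adj_sym (G : sgraph) : symmetric (@subdiv_adj G).
Proof. by case=> [x|f] [y|g]. Qed.

Lemma subdiv_adj_irr (G : sgraph) : irreflexive (@subdiv_adj G).
Proof. by case. Qed.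

Definition subdivision (G : sgraph) : sgraph :=
  SGraph (@subdiv_adj_sym G) (@subdiv_adj_irr G).

Definition walk (G : sgraph) (x y : G) (n : nat) : bool :=
  [exists p : n.-tuple G, path adj x p && (last x p == y)].

Lemma connect_walk (G : sgraph) (x y : G) :
  connect adj x y -> exists n, walk x y n.
Proof.
case/connectP=> p xp ->; exists (size p).
by apply/existsP; exists (in_tuple p); rewrite xp eqxx.
Qed.

(* None stands for the infinite distance between distinct components. *)
Definition dist (G : sgraph) (x y : G) : option nat :=
  if @idP (connect adj x y) is ReflectT xy then Some (ex_minn (connect_walk xy))
  else None.

Definition dist_geq (G : sgraph) (x y : G) (d : nat) : bool :=
  if dist x y is Some n then d <= n else true.

(* The ordered partition (V_1, ..., V_k) is the family of the fibers of c; the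
   indices are shifted, so that s_(i+1) is the element of S at position i. *)
Definition is_packing_coloring (G : sgraph) (S : seq nat)
    (c : {ffun G -> 'I_(size S)}) : bool :=
  [forall x, forall y, (x != y) && (c x == c y) ==>
     dist_geq x y (nth 0 S (c x)).+1].

Definition packing_colorable (G : sgraph) (S : seq nat) : bool :=
  [exists c : {ffun G -> 'I_(size S)}, is_packing_coloring c].

Lemma ex_packing_colorable (G : sgraph) :
  exists k, packing_colorable G (iota 1 k).
Proof.
exists #|G|; apply/existsP.
exists [ffun x => cast_ord (esym (size_iota 1 #|G|)) (enum_rank x)].
apply/forallP=> x; apply/forallP=> y; apply/implyP=> /andP[/eqP xy].
by rewrite !ffunE => /eqP/cast_ord_inj/enum_rank_inj.
Qed.

Definition packing_chromatic (G : sgraph) : nat :=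
  ex_minn (ex_packing_colorable G).

(* Main.v *)
Require Import Defs.
From mathcomp Require Import all_boot all_order all_algebra.
From mathcomp Require Import zify.

Set Implicit Arguments.
Unset Strict Implicit.
Unset Printing Implicit Defensive.

Import Order.TTheory GRing.Theory Num.Theory.

(** Call a colouring of the vertices of a graph by two light and two heavy
    colours good when adjacent vertices differ and no heavy colour is repeated
    at distance two. Passing from G to its subdivision doubles the distances
    between the vertices of G, so colouring every subdivision vertex 1 and
    using 2, 3 for the light and 4, 5 for the heavy colours turns a good
    colouring of G into a packing colouring of the subdivision
    ([colorable_packing]). It remains to colour G.

    Let W be a minimal set of vertices that induces a graph without good
    colouring. Delete from W a set s in which every vertex has at most one
    neighbour outside s. The vertices that remain are then not brought closer
    by the paths through s, so they keep a good colouring c, and only s is left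
    to be coloured. Choosing c with as many light vertices as possible helps in
    two ways. A heavy vertex next to s has only light neighbours outside s, for
    otherwise it could be made light. And a light vertex next to s that sees
    both heavy colours has no light neighbour outside s, so its light colour can
    be swapped freely. Hence all that s has to know about a vertex outside is
    one of seven states, and whether c always extends to s is a finite question
    about the graph induced by s ([reducible]). When the answer is yes, s cannot
    occur in W ([reducible_extends]).

    Call a vertex small when its degree in W is at most 2. The finite search
    shows that W has no vertex of degree at most 1 ([min_degree]), that two
    small vertices are neither adjacent ([small_nadj]) nor have a common
    neighbour ([small_common]), and that the three vertices of a path cannot
    all have a small neighbour ([spider_small]).
    Let S be the set of small vertices, T the set of their neighbours and F the
    rest. Each vertex of S has two neighbours in T and each vertex of T only one
    in S, so |T| >= 2 |S|. Each vertex of T has a neighbour in F, which has at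
    most three neighbours, so 3 |F| >= |T|. Thus 3 (|T| + |F|) >= 8 |S|, which
    says that the average degree of W is at least 30 / 11
    ([dense_uncolorable]); this contradicts the bound on mad. *)

(** * Colours, and states of coloured vertices *)

(** The first component tells the heavy colours from the light ones. *)
Definition color : Type := (bool * bool)%type.
Definition colors : seq color :=
  [:: (false, false); (false, true); (true, false); (true, true)].

(** The condition on two vertices at distance two. *)
Definition compatible (a b : color) := ~~ (a.1 && (a == b)).

Lemma compatibleC a b : compatible a b = compatible b a.
Proof. by case: a b => [[] []] [[] []]. Qed.

(** What a deleted vertex has to know about its coloured neighbour q:
    [Heavy b] when q has heavy colour b, so that no other neighbour of q is
    heavy; [Light a k] when q has light colour a and sees no other heavy colour
    than k; [Loose] when q is light and sees both heavy colours, so that its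
    light colour may be swapped. If q sees no heavy colour, k is arbitrary: this
    only forbids more. *)
Inductive state := Heavy of bool | Light of bool & bool | Loose.

Definition states : seq state :=
  [:: Heavy false; Heavy true; Loose; Light false false; Light false true;
      Light true false; Light true true].

Definition same_state s t :=
  match s, t with
  | Heavy b, Heavy b' => b == b'
  | Light a k, Light a' k' => (a == a') && (k == k')
  | Loose, Loose => true
  | _, _ => false
  end.

(** The colours left to a neighbour of a vertex in state [st]. A loose vertex
    can give way to either light colour. *)
Definition allows st (a : color) :=
  match st with
  | Heavy b => a != (true, b)
  | Light l k => (a != (false, l)) && (a != (true, k))
  | Loose => ~~ a.1
  end.

(** The heavy colour of a vertex also binds at distance two. *)
Definition allows_near st (a : color) :=
  if st is Heavy b then a != (true, b) else true.

(** * Configurations and their finite search *)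

(** A configuration is a graph on the positions 0, 1, ... to be found inside a
    larger one: [nb] lists the neighbours of each position, [cdeg] bounds the
    degrees in the larger graph, and [far] is a set of positions no two of which
    have a common neighbour outside the configuration. *)
Record config := Config { nb : seq (seq nat); cdeg : seq nat; far : seq nat }.

Section Search.
Variable K : config.
Let n := size (nb K).
Definition cnbrs i := nth [::] (nb K) i.
Definition cadj i j := j \in cnbrs i.
Definition attached i := size (cnbrs i) < nth 0 (cdeg K) i.

(** The bound on the degree leaves at most one neighbour outside. *)
Definition well_formed :=
  all (fun i => [&& uniq (cnbrs i), all (gtn n) (cnbrs i),
         nth 0 (cdeg K) i <= (size (cnbrs i)).+1, ~~ cadj i i &
         all (fun j => cadj i j == cadj j i) (iota 0 n)]) (iota 0 n).

Definition cproper (d : seq color) :=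
  let x i := nth (false, false) d i in
  all (fun i => all (fun j =>
    (cadj i j ==> (x i != x j)) &&
    ((i != j) && has (fun k => cadj k i && cadj k j) (iota 0 n) ==>
       compatible (x i) (x j))) (iota 0 n)) (iota 0 n).

(** Whether [d] suits an outside neighbour of position [i] in state [st], when
    the positions in [done] have been given states. Two positions with outside
    neighbours in the same state may have the same outside neighbour, hence be
    at distance two: unless they are [far], a heavy colour is not repeated. *)
Definition cboundary i st (done : seq (nat * state)) (d : seq color) :=
  let x i := nth (false, false) d i in
  [&& allows st (x i), all (fun j => allows_near st (x j)) (cnbrs i) &
      all (fun p => same_state st p.2 ==>
        ((i \in far K) && (p.1 \in far K)) || compatible (x i) (x p.1)) done].

(** [ds] holds the colourings that suit the states chosen so far; whatever
    states come next, one of them has to survive. *)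
Fixpoint search todo done ds :=
  if todo is i :: todo' then
    all (fun st => search todo' ((i, st) :: done)
                     (filter (cboundary i st done) ds)) states
  else ds != [::].

Definition reducible :=
  well_formed &&
  search (filter attached (iota 0 n)) [::]
    (filter cproper (iter n (fun ds => [seq a :: d | a <- colors, d <- ds])
                       [:: [::]])).

End Search.

Lemma same_state_refl s : same_state s s.
Proof. by case: s => [[]|[] []|]. Qed.

Lemma same_stateC s t : same_state s t = same_state t s.
Proof.
by case: s t => [a|a k|] [b|b l|] //=; rewrite ![_ == a]eq_sym ?[_ == k]eq_sym.
Qed.

Section SearchP.
Variables (K : config) (sigma : nat -> state).
Let n := size (nb K).

Let tagged i := (i, sigma i).

Lemma searchP todo done ds :
  search K todo (map tagged done) ds ->
  exists2 d, d \in ds &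
    (forall i, i \in todo -> cboundary K i (sigma i) [::] d) /\
    (forall i j, i \in todo -> j \in todo ++ done -> i != j ->
       same_state (sigma i) (sigma j) ->
       ((i \in far K) && (j \in far K)) ||
         compatible (nth (false, false) d i) (nth (false, false) d j)).
Proof.
elim: todo done ds => [|i todo IH] done ds /=.
  by case: ds => // d ds _; exists d; rewrite ?mem_head.
(* The search has been through all seven states, among them [sigma i]. *)
move=> /andP[h0 /andP[h1 /and5P[h2 h3 h4 h5 /andP[h6 _]]]].
have {h0 h1 h2 h3 h4 h5 h6} : search K todo (map tagged (i :: done))
    (filter (cboundary K i (sigma i) (map tagged done)) ds).
  by rewrite /= /tagged; case: (sigma i) => [[]|[] []|].
move=> /IH[d]; rewrite mem_filter => /andP[/and3P[di dnear dfar] d_ds] [bd cmp].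
exists d => //; split=> [j|j k].
  rewrite inE => /orP[/eqP->|/bd//].
  by rewrite /cboundary di dnear.
have new k' : k' \in done -> same_state (sigma i) (sigma k') ->
    ((i \in far K) && (k' \in far K)) ||
      compatible (nth (false, false) d i) (nth (false, false) d k').
  by move=> k'd; move: dfar; rewrite all_map => /allP/(_ k' k'd)/implyP.
rewrite !inE mem_cat; case/orP=> [/eqP->|jt]; case/or3P=> [/eqP->|kt|kd] jk st.
- by rewrite eqxx in jk.
- rewrite andbC compatibleC; apply: cmp => //; last by rewrite same_stateC.
    by rewrite mem_cat mem_head orbT.
  by rewrite eq_sym.
- exact: new.
- by apply: cmp => //; rewrite mem_cat mem_head orbT.
- by apply: cmp => //; rewrite mem_cat kt.
- by apply: cmp => //; rewrite mem_cat inE kd !orbT.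
Qed.

Lemma reducibleP : reducible K ->
  exists d,
    [/\ cproper K d,
        forall i, i < n -> attached K i -> cboundary K i (sigma i) [::] d &
        forall i j, i < n -> j < n -> attached K i -> attached K j ->
          i != j -> same_state (sigma i) (sigma j) ->
          ((i \in far K) && (j \in far K)) ||
          compatible (nth (false, false) d i) (nth (false, false) d j)].
Proof.
case/andP=> _ /(@searchP _ [::])[d]; rewrite mem_filter => /andP[dP _] [bd cmp].
exists d; split=> // [i ltin ati|i j ltin ltjn ati atj].
  by apply: bd; rewrite mem_filter ati mem_iota.
by apply: cmp; rewrite ?cats0 mem_filter mem_iota ?ati ?atj.
Qed.

End SearchP.

(** * Good colourings *)

Section Colorings.
Variable G : sgraph.
Implicit Types (W U : {set G}) (x y z q : G) (c : {ffun G -> color}).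

Definition nbrs W x := [set y in W | adj x y].

Lemma in_nbrs W x y : (y \in nbrs W x) = (y \in W) && adj x y.
Proof. by rewrite inE. Qed.

(** The distance is taken in the graph induced by W: the common neighbour y is
    in W. *)
Definition good W c :=
  [forall x in W, forall y in nbrs W x, c x != c y] &&
  [forall y in W, forall x in nbrs W y, forall z in nbrs W y,
     (x != z) ==> compatible (c x) (c z)].

Definition colorable W := [exists c, good W c].

Lemma goodP W c :
  reflect ((forall x y, x \in W -> y \in W -> adj x y -> c x != c y) /\
           (forall x y z, x \in W -> y \in W -> z \in W ->
              adj y x -> adj y z -> x != z -> compatible (c x) (c z)))
          (good W c).
Proof.
apply: (iffP andP) => -[edg chr]; split.
- move=> x y xW yW xy; move/forall_inP: edg => /(_ x xW)/forall_inP; apply.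
  by rewrite in_nbrs yW.
- move=> x y z xW yW zW yx yz xz.
  move/forall_inP: chr => /(_ y yW)/forall_inP/(_ x).
  rewrite in_nbrs xW yx => /(_ isT)/forall_inP/(_ z).
  by rewrite in_nbrs zW yz xz; apply.
- apply/forall_inP=> x xW; apply/forall_inP=> y; rewrite in_nbrs => /andP[yW].
  exact: edg.
apply/forall_inP=> y yW; apply/forall_inP=> x; rewrite in_nbrs => /andP[xW yx].
apply/forall_inP=> z; rewrite in_nbrs => /andP[zW yz]; apply/implyP.
exact: chr yx yz.
Qed.

(** A good colouring with as many light vertices as possible will do: if a heavy
    vertex q with at most two neighbours has a heavy neighbour x, its other
    neighbour p leaves a light colour to q. *)
Lemma colorable_balanced W : colorable W ->
  exists2 c, good W c &
    forall q x, q \in W -> x \in W -> adj q x -> #|nbrs W q| <= 2 ->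
      (c q).1 -> ~~ (c x).1.
Proof.
case/existsP=> c0 c0P; pose light c := [set x in W | ~~ (c x).1].
case: (@arg_maxnP _ c0 (good W) (fun c => #|light c|) c0P) => c cP cmax.
exists c => // q x qW xW qx degq cq; apply/negP=> cx.
have [edg chr] := goodP _ _ cP.
pose p := odflt q [pick y in nbrs W q :\ x].
(* If x is the only neighbour of q, then p is q, and any light colour fits. *)
have onlyp y : y \in W -> adj q y -> y != x -> y = p.
  move=> yW qy yx; rewrite /p; case: pickP => [z zP|/(_ y)]; last first.
    by rewrite in_setD1 in_nbrs yx yW qy.
  have le1 : #|nbrs W q :\ x| <= 1.
    by move: degq; rewrite (cardsD1 x) in_nbrs xW qx add1n ltnS.
  by apply: (card_le1_eqP le1); rewrite // in_setD1 in_nbrs yx yW.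
pose c' : {ffun G -> color} :=
  [ffun y => if y == q then (false, ~~ (c p).2) else c y].
have c'q : c' q = (false, ~~ (c p).2) by rewrite ffunE eqxx.
have c'N y : y != q -> c' y = c y by rewrite ffunE => /negbTE->.
have qedge y : y \in W -> adj q y -> c' q != c' y.
  move=> yW qy; have yq : y != q by apply: contraTneq qy => ->; rewrite adj_irr.
  rewrite c'q c'N //; have [->|yx] := eqVneq y x.
    by rewrite -eq_sym; apply: contraTneq cx => ->.
  by rewrite (onlyp y) //; case: (c p) => [[] []].
have c'P : good W c'.
  apply/goodP; split=> [y z yW zW yz|y z t yW zW tW zy zt yt].
    have [yq|yq] := eqVneq y q; first by rewrite yq qedge // -yq.
    have [zq|zq] := eqVneq z q; first by rewrite eq_sym zq qedge // -zq adj_sym.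
    by rewrite !c'N // edg.
  have [->|yq] := eqVneq y q; first by rewrite c'q.
  have [->|tq] := eqVneq t q; first by rewrite compatibleC c'q.
  by rewrite !c'N // (chr y z).
have := cmax c' c'P; rewrite /geq /= leqNgt => /negP; apply.
apply/proper_card/properP; split.
  apply/subsetP=> y; rewrite !inE => /andP[-> cy] /=; rewrite ffunE.
  by case: ifP.
by exists q; rewrite !inE ?c'q ?qW //= cq.
Qed.

Hypothesis subcubicG : forall x, degree x <= 3.

(** * Extending a colouring to a configuration *)

(** The non-edges matter as much as the edges: [s] induces exactly the graph of
    the configuration. *)
Record occurs K W x0 (s : seq G) : Prop := Occurs {
  occurs_uniq : uniq s;
  occurs_size : size s = size (nb K);
  occurs_sub : {subset s <= W};
  occurs_adj : forall i j, i < size s -> j < size s -> i < j ->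
    adj (nth x0 s i) (nth x0 s j) = cadj K i j;
  occurs_deg : forall i, i < size s ->
    #|nbrs W (nth x0 s i)| <= nth 0 (cdeg K) i;
  occurs_far : forall i j q, i < size s -> j < size s -> i != j ->
    i \in far K -> j \in far K -> q \in W -> q \notin s ->
    adj q (nth x0 s i) -> adj q (nth x0 s j) -> false }.

Definition seen U c q b := [exists x in nbrs U q, c x == (true, b)].

Definition loose U c q := [&& ~~ (c q).1, seen U c q true & seen U c q false].

Definition state_of U c q :=
  if (c q).1 then Heavy (c q).2
  else if loose U c q then Loose else Light (c q).2 (seen U c q true).

Lemma seenP U c q b :
  reflect (exists2 x, (x \in U) && adj q x & c x = (true, b)) (seen U c q b).
Proof.
apply: (iffP existsP) => [[x]|[x xU cx]].
  by rewrite in_nbrs => /andP[xU /eqP]; exists x.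
by exists x; rewrite in_nbrs xU cx eqxx.
Qed.

Lemma mem_third_nbr q x y z t : adj q x -> adj q y -> adj q z -> adj q t ->
  x != y -> x != z -> y != z -> t \in [:: x; y; z].
Proof.
move=> qx qy qz qt xy xz yz; have := subcubicG q; rewrite /degree.
apply: contraTT => tN; rewrite -ltnNge.
have u4 : uniq [:: t; x; y; z] by rewrite /= tN !inE negb_or xy xz yz.
have <- : #|[:: t; x; y; z]| = 4 := card_uniqP u4.
apply: subset_leq_card.
by apply/subsetP=> a; rewrite !inE => /or4P[] /eqP->.
Qed.

Lemma mem_seq3P (T : eqType) (x y z t : T) :
  t \in [:: x; y; z] -> [\/ t = x, t = y | t = z].
Proof.
by rewrite !inE => /or3P[] /eqP; [constructor 1|constructor 2|constructor 3].
Qed.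

(** Colour the complement of s in a balanced way, read off the states of the
    neighbours of s, let the search provide a colouring of s, and swap the light
    colour of those loose vertices that clash with it. *)
Lemma reducible_extends K W x0 s : reducible K -> occurs K W x0 s ->
  colorable (W :\: [set x in s]) -> colorable W.
Proof.
move=> redK [s_uniq s_size sW adjE degE farE] /colorable_balanced[c cP cbal].
set U := W :\: _ in cP cbal.
have inU x : (x \in U) = (x \notin s) && (x \in W) by rewrite !inE.
have UW : U \subset W by apply: subsetDl.
have [edg chr] := goodP _ _ cP.
set n := size s in adjE degE farE; rewrite -/n in s_size.
have wf i : i < n -> [/\ uniq (cnbrs K i), {in cnbrs K i, forall j, j < n},
    nth 0 (cdeg K) i <= (size (cnbrs K i)).+1, ~~ cadj K i i &
    forall j, j < n -> cadj K i j = cadj K j i].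
  case/andP: redK => /allP/(_ i) + _; rewrite mem_iota -s_size => wfK ltin.
  have /and5P[-> /allP ? -> -> /allP sym] := wfK ltin; split=> // j ltjn.
  by apply/eqP; apply: sym; rewrite mem_iota.
pose v i := nth x0 s i.
have vs i : i < n -> v i \in s by apply: mem_nth.
have v_adj i j : i < n -> j < n -> adj (v i) (v j) = cadj K i j.
  move=> ltin ltjn; have [_ _ _ irr sym] := wf i ltin.
  have [ltij|ltji|eqij] := ltngtP i j; first by rewrite /v adjE.
    by rewrite adj_sym sym // /v adjE.
  by rewrite -eqij adj_irr (negbTE irr).
(* The edges inside s use up all but at most one of the neighbours. *)
have v_out i : i < n ->
    (size (cnbrs K i) + #|nbrs U (v i)| <= nth 0 (cdeg K) i).
  move=> ltin; have [nb_uniq nb_lt _ _ _] := wf i ltin.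
  apply: leq_trans (degE i ltin).
  have L_uniq : uniq (map v (cnbrs K i)).
    rewrite map_inj_in_uniq // => j k /nb_lt ltjn /nb_lt ltkn /eqP.
    by rewrite nth_uniq // => /eqP.
  rewrite -(size_map v) -(card_uniqP L_uniq) -cardUI.
  rewrite [X in _ + X]eq_card0 ?addn0; last first.
    move=> x; rewrite !inE; apply/negP=> /andP[/mapP[j /nb_lt ltjn ->]].
    by rewrite vs.
  apply/subset_leq_card/subsetP=> x; rewrite !inE.
  case/orP=> [/mapP[j ij ->]|/andP[/andP[_ ->] ->//]].
  have ltjn := nb_lt j ij.
  by rewrite sW ?vs //= -/(v i) v_adj.
have out_uniq i q q' : i < n -> q \in U -> q' \in U ->
    adj (v i) q -> adj (v i) q' -> q = q'.
  move=> ltin qU q'U iq iq'; have [_ _ deg_le _ _] := wf i ltin.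
  have le1 : #|nbrs U (v i)| <= 1.
    by have := leq_trans (v_out i ltin) deg_le; rewrite -addn1 leq_add2l.
  by apply: (card_le1_eqP le1); rewrite in_nbrs ?qU ?q'U.
have out_attached i q : i < n -> q \in U -> adj (v i) q -> attached K i.
  move=> ltin qU iq; apply: leq_trans (v_out i ltin).
  rewrite -addn1 leq_add2l card_gt0; apply/set0Pn; exists q.
  by rewrite in_nbrs qU.
pose sigma i := if [pick q in nbrs U (v i)] is Some q then state_of U c q
                else Loose.
have sigmaE i q : i < n -> q \in U -> adj (v i) q -> sigma i = state_of U c q.
  move=> ltin qU iq; rewrite /sigma; case: pickP => [q'|/(_ q)]; last first.
    by rewrite in_nbrs qU iq.
  by rewrite in_nbrs => /andP[q'U iq']; rewrite (out_uniq i q q').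
have [d [dP dbd dcmp]] := reducibleP sigma redK.
rewrite -s_size in dbd dcmp.
pose dv x := nth (false, false) d (index x s).
have s_idx x : x \in s -> exists2 i, i < n & x = v i.
  by move=> xs; exists (index x s); rewrite ?index_mem // /v nth_index.
have dvE i : i < n -> dv (v i) = nth (false, false) d i.
  by move=> ltin; rewrite /dv index_uniq.
have in_edge x y : x \in s -> y \in s -> adj x y -> dv x != dv y.
  move=> /s_idx[i ltin ->] /s_idx[j ltjn ->]; rewrite v_adj // !dvE // => ij.
  move/allP: dP => /(_ i); rewrite mem_iota -s_size => /(_ ltin)/allP/(_ j).
  by rewrite mem_iota => /(_ ltjn)/andP[/implyP/(_ ij)].
have in_cherry x y z : x \in s -> y \in s -> z \in s -> adj y x -> adj y z ->
    x != z -> compatible (dv x) (dv z).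
  move=> /s_idx[i ltin ->] /s_idx[k ltkn ->] /s_idx[j ltjn ->].
  rewrite !v_adj // !dvE // => ki kj ij.
  have {}ij : i != j by apply: contraNneq ij => ->.
  move/allP: dP => /(_ i); rewrite mem_iota -s_size => /(_ ltin)/allP/(_ j).
  rewrite mem_iota => /(_ ltjn)/andP[_ /implyP]; apply.
  by rewrite ij; apply/hasP; exists k; rewrite ?mem_iota ?ki.
have out_allows x q : x \in s -> q \in U -> adj x q ->
    allows (state_of U c q) (dv x).
  move=> /s_idx[i ltin ->] qU iq; rewrite dvE // -(sigmaE i) //.
  by have /and3P[] := dbd i ltin (out_attached i q ltin qU iq).
have out_near x y q : x \in s -> y \in s -> q \in U -> adj x y -> adj x q ->
    allows_near (state_of U c q) (dv y).
  move=> /s_idx[i ltin ->] /s_idx[j ltjn ->] qU; rewrite v_adj // => ij iq.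
  rewrite dvE // -(sigmaE i) //.
  have /and3P[_ /allP near _] := dbd i ltin (out_attached i q ltin qU iq).
  exact: near.
have out_cherry x y q : x \in s -> y \in s -> q \in U -> adj x q -> adj y q ->
    x != y -> compatible (dv x) (dv y).
  move=> /s_idx[i ltin ->] /s_idx[j ltjn ->] qU iq jq ij; rewrite !dvE //.
  have {}ij : i != j by apply: contraNneq ij => ->.
  have st : same_state (sigma i) (sigma j).
    by rewrite (sigmaE i q) // (sigmaE j q) // same_state_refl.
  have /orP[/andP[ifar jfar]|//] := dcmp i j ltin ltjn
    (out_attached i q ltin qU iq) (out_attached j q ltjn qU jq) ij st.
  move: (qU); rewrite inU => /andP[qs qW]; exfalso.
  move: (farE i j q ltin ltjn ij ifar jfar qW qs).
  by rewrite ![adj q _]adj_sym => /(_ iq jq).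
(* A loose vertex already has two heavy neighbours outside s, so x is its third
   neighbour, and swapping its light colour harms nobody. *)
have loose_nbr q x y : q \in U -> loose U c q -> x \in s -> adj x q ->
    y \in W -> adj q y -> y = x \/ y \in U /\ (c y).1.
  move=> qU /and3P[_ /seenP[a /andP[aU qa] ca] /seenP[b /andP[bU qb] cb]] xs xq.
  move=> yW qy; have ab : a != b by apply: contra_eq_neq ca => ->; rewrite cb.
  have [aN bN] : a \notin s /\ b \notin s.
    by move: aU bU; rewrite !inU => /andP[? _] /andP[? _].
  have ax : a != x by apply: contraNneq aN => ->.
  have bx : b != x by apply: contraNneq bN => ->.
  have qx : adj q x by rewrite adj_sym.
  have /mem_seq3P := mem_third_nbr qa qb qx qy ab ax bx.
  by case=> ->; [right; rewrite ca | right; rewrite cb | left].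
pose swap q := loose U c q && has (fun t => adj q t && (dv t == c q)) s.
pose c' : {ffun G -> color} := [ffun x =>
  if x \in s then dv x else if swap x then (false, ~~ (c x).2) else c x].
have c'in x : x \in s -> c' x = dv x by rewrite ffunE => ->.
have c'out x : x \in U -> c' x = if swap x then (false, ~~ (c x).2) else c x.
  by rewrite inU ffunE => /andP[/negbTE->].
have c'heavy x : x \in U -> (c' x).1 = (c x).1.
  move=> /c'out->; case: ifP => // /andP[/andP[light _] _].
  by rewrite (negbTE light).
have swap_edge x y : x \in U -> y \in U -> adj x y -> swap x -> c' x != c' y.
  move=> xU yU xy swx; have /andP[xl /hasP[t ts /andP[xt _]]] := swx.
  have yW : y \in W by apply: (subsetP UW).
  have [yt|[_ cy]] := loose_nbr x t y xU xl ts (etrans (adj_sym _ _) xt) yW xy.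
    by move: yU; rewrite inU yt ts.
  by apply: contraTneq cy; rewrite -c'heavy // => <-; rewrite c'out // swx.
have io_edge x y : x \in s -> y \in U -> adj x y -> c' x != c' y.
  move=> xs yU xy; have := out_allows x y xs yU xy.
  rewrite c'in // c'out // /swap /state_of.
  case: ifPn => [cy|cy].
    rewrite /loose cy /=; apply: contraNneq => ->.
    by rewrite {1}(surjective_pairing (c y)) cy.
  have [yl|_] /= := boolP (loose U c y); last first.
    case/andP=> + _; apply: contraNneq => ->.
    by rewrite (surjective_pairing (c y)) (negbTE cy).
  move=> dx; case: hasP => [[t ts /andP[yt /eqP dt]]|noswap].
    have tW := sW _ ts.
    have [tx|[]] := loose_nbr y x t yU yl xs xy tW yt; last by rewrite inU ts.
    by rewrite -tx dt; case: (c y) cy => [[] []].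
  apply/negP=> /eqP dx'; case: noswap; exists x => //.
  by rewrite adj_sym xy dx' eqxx.
have split_W x : x \in W -> x \in s \/ x \in U.
  by move=> xW; rewrite inU xW andbT; case: (boolP (x \in s)); [left|right].
have io_cherry x y z : x \in s -> y \in W -> z \in U -> adj y x -> adj y z ->
    compatible (c' x) (c' z).
  move=> xs yW zU yx yz; apply/negP=> /andP[+ /eqP xz].
  rewrite xz c'heavy // => cz.
  have {}xz : dv x = c z.
    move: xz; rewrite c'in // c'out //; case: ifP => // /andP[/andP[]].
    by rewrite cz.
  have {}cz : c z = (true, (c z).2) by rewrite {1}(surjective_pairing (c z)) cz.
  have [ys|yU] := split_W y yW.
    have := out_near y x z ys xs zU yx yz.
    by rewrite /state_of cz /= xz cz eqxx.
  have xy : adj x y by rewrite adj_sym.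
  have := out_allows x y xs yU xy; rewrite /state_of.
  have zseen : seen U c y (c z).2 by apply/seenP; exists z; rewrite // zU yz.
  case: ifPn => [cy|cy].
    (* The state of y does not mention the colour of z: c is balanced. *)
    have deg2 : #|nbrs U y| <= 2.
      have : #|nbrs U y| < 3; last by [].
      apply: leq_trans (subcubicG y).
      apply/proper_card/properP; split.
        by apply/subsetP=> a; rewrite !inE => /andP[].
      by exists x; rewrite !inE // xs.
    by have := cbal y z yU zU yz deg2 cy; rewrite cz.
  rewrite xz cz; case: ifPn => [_ //|nl] /andP[_].
  move: zseen nl; rewrite /loose cy; case: (c z).2 => [->|->] //=.
  by rewrite andbT => /negbTE->.
apply/existsP; exists c'; apply/goodP; split.
  move=> x y /split_W[xs|xU] /split_W[ys|yU] xy.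
  - by rewrite !c'in // in_edge.
  - exact: io_edge.
  - by rewrite eq_sym io_edge // adj_sym.
  have [swx|swx] := boolP (swap x); first exact: swap_edge.
  have [swy|swy] := boolP (swap y).
    by rewrite eq_sym swap_edge // adj_sym.
  by rewrite !c'out // (negbTE swx) (negbTE swy) edg.
move=> x y z /split_W[xs|xU] yW /split_W[zs|zU] yx yz xz.
- rewrite !c'in //; have [ys|yU] := split_W y yW; first exact: (in_cherry _ y).
  by apply: (out_cherry _ _ y); rewrite // adj_sym.
- exact: (io_cherry _ y).
- by rewrite compatibleC; apply: (io_cherry _ y).
(* Through a vertex of s no two vertices outside s come to distance two. *)
have [ys|yU] := split_W y yW.
  have [i ltin yE] := s_idx y ys.
  by case/eqP: xz; apply: (out_uniq i); rewrite -?yE.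
apply/negP=> /andP[]; rewrite c'heavy // => cx /eqP xz'.
have cz : (c z).1 by rewrite -c'heavy // -xz' c'heavy.
have := chr x y z xU yU zU yx yz xz; rewrite /compatible cx.
move: xz'; rewrite !c'out // /swap /loose cx cz /= => ->.
by rewrite eqxx.
Qed.

(** * Configurations that a minimal uncolourable set avoids *)

Section Minimal.
Variable W : {set G}.
Hypothesis uncolorableW : ~~ colorable W.
Hypothesis colorable_proper : forall U, U \proper W -> colorable U.

Definition small x := (x \in W) && (#|nbrs W x| <= 2).

Lemma small_in x : small x -> x \in W. Proof. by case/andP. Qed.

Lemma small_deg x : small x -> #|nbrs W x| <= 2. Proof. by case/andP. Qed.

Lemma deg_le3 x : #|nbrs W x| <= 3.
Proof.
apply: leq_trans (subcubicG x); apply/subset_leq_card/subsetP=> y.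
by rewrite !inE => /andP[].
Qed.

Lemma reducible_absurd K x0 s : reducible K -> x0 \in s -> ~ occurs K W x0 s.
Proof.
move=> redK x0s occ; case/negP: uncolorableW.
have x0W := occurs_sub occ x0s.
apply: reducible_extends redK occ _; apply: colorable_proper.
apply/properP; split; first exact: subsetDl.
by exists x0; rewrite ?inE ?x0s.
Qed.

Lemma adj_neq x y : adj x y -> x != y.
Proof. by apply: contraTneq => ->; rewrite adj_irr. Qed.

Lemma small_nbrs v x y z : small v -> x \in W -> y \in W -> z \in W ->
  adj v x -> adj v y -> adj v z -> x != y -> z = x \/ z = y.
Proof.
move=> /small_deg degv xW yW zW vx vy vz xy.
have /setP/(_ z) : [set x; y] = nbrs W v.
  apply/eqP; rewrite eqEcard cards2 xy degv andbT.
  by apply/subsetP=> a; rewrite in_nbrs !inE => /orP[]/eqP->; apply/andP.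
by rewrite in_nbrs zW vz !inE => /orP[]/eqP; [left | right].
Qed.

Definition config_leaf := Config [:: [::]] [:: 1] [::].

Lemma min_degree x : x \in W -> 1 < #|nbrs W x|.
Proof.
move=> xW; rewrite ltnNge; apply/negP=> degx.
apply: (@reducible_absurd config_leaf x [:: x]) => //; first exact: mem_head.
split=> //.
- by move=> y; rewrite inE => /eqP->.
- by case=> [|i] [|j] //=.
- by case.
Qed.

Definition config_edge := Config [:: [:: 1]; [:: 0]] [:: 2; 2] [::].

Lemma small_nadj x y : small x -> small y -> adj x y = false.
Proof.
move=> sx sy; apply/negP=> xy.
apply: (@reducible_absurd config_edge x [:: x; y]) => //; first exact: mem_head.
split=> //.
- by rewrite /= inE adj_neq.
- by apply/allP; rewrite /= !small_in.
- by case=> [|[|i]] [|[|j]] //=.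
- by case=> [|[|i]] //= _; apply: small_deg.
Qed.

Definition config_path :=
  Config [:: [:: 1]; [:: 0; 2]; [:: 1]] [:: 2; 3; 2] [::].

Lemma small_common u x y : u \in W -> small x -> small y ->
  adj u x -> adj u y -> x = y.
Proof.
move=> uW sx sy ux uy; apply/eqP/negP=> /negP xy.
have xu : adj x u by rewrite adj_sym.
apply: (@reducible_absurd config_path x [:: x; u; y]) => //.
  exact: mem_head.
split=> //.
- by rewrite /= !inE !negb_or xy !adj_neq.
- by apply/allP; rewrite /= uW !small_in.
- by case=> [|[|[|i]]] [|[|[|j]]] //= _ _ _; apply: small_nadj.
- by case=> [|[|[|i]]] //= _; rewrite ?small_deg ?deg_le3.
Qed.

(** The flag is for a possible chord between the neighbours of the small vertex,
    which is at position 2. *)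
Definition config_square b := if b then
    Config [:: [:: 1; 3]; [:: 0; 2; 3]; [:: 1; 3]; [:: 0; 1; 2]]
      [:: 3; 3; 2; 3] [::]
  else Config [:: [:: 1; 3]; [:: 0; 2]; [:: 1; 3]; [:: 0; 2]]
      [:: 3; 3; 2; 3] [::].

(** This keeps two legs of a spider from sharing their small end. *)
Lemma square_small x u w1 w2 : small x -> u \in W -> w1 \in W -> w2 \in W ->
  w1 != w2 -> adj x w1 -> adj x w2 -> adj u w1 -> adj u w2 -> u = x.
Proof.
move=> sx uW w1W w2W w12 xw1 xw2 uw1 uw2; apply/eqP/negP=> /negP ux.
have w1x : adj w1 x by rewrite adj_sym.
have uxF : adj u x = false.
  apply/negP; rewrite adj_sym => xu.
  have [eq_u|eq_u] := small_nbrs sx w1W w2W uW xw1 xw2 xu w12.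
    by rewrite eq_u adj_irr in uw1.
  by rewrite eq_u adj_irr in uw2.
apply: (@reducible_absurd (config_square (adj w1 w2)) u [:: u; w1; x; w2]).
- by case: (adj w1 w2); vm_compute.
- exact: mem_head.
split.
- by rewrite /= !inE !negb_or ux w12 !adj_neq.
- by case: (adj w1 w2).
- by apply/allP; rewrite /= uW w1W w2W small_in.
- by case=> [|[|[|[|i]]]] [|[|[|[|j]]]] //= _ _ _; rewrite /config_square;
    case: ifP.
- by case=> [|[|[|[|i]]]] //= _; rewrite /config_square; case: ifP => /= _;
    rewrite ?deg_le3 ?small_deg.
- by rewrite /config_square; case: ifP.
Qed.

(** A triangle with a small vertex, at position 0, and a small vertex at
    distance two from the triangle. *)
Definition config_triangle :=
  Config [:: [:: 1; 2]; [:: 0; 2; 3]; [:: 0; 1]; [:: 1; 4]; [:: 3]]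
    [:: 2; 3; 3; 3; 2] [::].

Lemma triangle_small v u w a x : small v -> small x ->
  u \in W -> w \in W -> a \in W -> adj v u -> adj v w -> adj u w -> adj u a ->
  a != v -> a != w -> adj a x -> x = v.
Proof.
move=> sv sx uW wW aW vu vw uw ua av aw ax; apply/eqP/negP=> /negP xv.
have vW := small_in sv; have xW := small_in sx.
have va : adj v a = false.
  apply/negP=> va.
  have [eq_a|eq_a] := small_nbrs sv uW wW aW vu vw va (adj_neq uw).
    by rewrite eq_a adj_irr in ua.
  by rewrite eq_a eqxx in aw.
have vx := small_nadj sv sx.
have ux : adj u x = false.
  apply: contraNF xv => ux; apply/eqP; apply: (small_common uW) => //.
  by rewrite adj_sym.
have wx : adj w x = false.
  apply: contraNF xv => wx; apply/eqP; apply: (small_common wW) => //.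
  by rewrite adj_sym.
have wa : adj w a = false.
  apply: contraNF av => wa; apply/eqP.
  by apply: (square_small sv aW uW wW) => //; rewrite ?adj_neq // adj_sym.
have u_x : u != x by apply: contraTneq vu => ->; rewrite small_nadj.
have w_x : w != x by apply: contraTneq vw => ->; rewrite small_nadj.
apply: (@reducible_absurd config_triangle v [:: v; u; w; a; x]) => //.
- exact: mem_head.
split=> //.
- rewrite /= !inE !negb_or ![v == _]eq_sym av xv [w == a]eq_sym aw u_x w_x.
  by rewrite ![_ == v]eq_sym !adj_neq.
- by apply/allP; rewrite /= vW uW wW aW xW.
- by case=> [|[|[|[|[|i]]]]] [|[|[|[|[|j]]]]] //=.
- by case=> [|[|[|[|[|i]]]]] //= _; rewrite ?small_deg ?deg_le3.
Qed.

(** Three legs at position 1, a small vertex at the end of each: the legs are 0,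
    then 2 and 4, then 3 and 5. The flag is for a possible edge between 2 and 3.
    Outside neighbours may be shared, but not by two of the small ends 0, 4, 5,
    by [small_common]. *)
Definition config_spider b := if b then
    Config [:: [:: 1]; [:: 0; 2; 3]; [:: 1; 3; 4]; [:: 1; 2; 5]; [:: 2]; [:: 3]]
      [:: 2; 3; 3; 3; 2; 2] [::]
  else
    Config [:: [:: 1]; [:: 0; 2; 3]; [:: 1; 4]; [:: 1; 5]; [:: 2]; [:: 3]]
      [:: 2; 3; 3; 3; 2; 2] [:: 0; 4; 5].

Lemma spider_reducible b : reducible (config_spider b).
Proof. by case: b; vm_compute. Qed.

(** The vertices u, a, b and the small vertices v, x, y attached to them form a
    spider, unless two of v, x, y coincide and close a triangle or a cycle of
    length 4. *)
Lemma spider_small u v a b x y : small v -> small x -> small y ->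
  u \in W -> a \in W -> b \in W -> adj u v -> adj u a -> adj u b ->
  adj a x -> adj b y -> a = b.
Proof.
move=> sv sx sy uW aW bW uv ua ub ax b_y; apply/eqP/negP=> /negP ab.
have vW := small_in sv; have xW := small_in sx; have yW := small_in sy.
have vu : adj v u by rewrite adj_sym.
have not_small z t : small t -> adj z t -> ~~ small z.
  by move=> st; apply: contraTN => sz; rewrite small_nadj.
have uN := not_small u v sv uv; have aN := not_small a x sx ax.
have bN := not_small b y sy b_y.
have neq z t : ~~ small z -> small t -> z != t.
  by move=> zN st; apply: contraNneq zN => ->.
have xv : x != v.
  apply/eqP=> xv; have va : adj v a by rewrite -xv adj_sym.
  have yv : y = v.
    apply: (triangle_small sv sy uW aW bW) => //; first exact: neq.
    by rewrite eq_sym.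
  have vb : adj v b by rewrite -yv adj_sym.
  have [eq_b|eq_b] := small_nbrs sv uW aW bW vu va vb (adj_neq ua).
    by rewrite eq_b adj_irr in ub.
  by rewrite eq_b eqxx in ab.
have yv : y != v.
  apply/eqP=> yv; have vb : adj v b by rewrite -yv adj_sym.
  case/eqP: xv.
  by apply: (triangle_small sv sx uW bW aW) => //; apply: neq.
have xy : x != y.
  apply/eqP=> xy; case/negP: uN.
  rewrite (@square_small x u a b) // adj_sym //.
  by rewrite xy.
have far_ab z s t : s != t -> small s -> small t -> z \in W -> adj z s ->
    adj z t = false.
  move=> st ss sst zW zs; apply: contraNF st => zt.
  by rewrite (small_common zW ss sst zs zt).
have va : adj v a = false by rewrite adj_sym (far_ab a x v).
have vb : adj v b = false by rewrite adj_sym (far_ab b y v).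
have vx := small_nadj sv sx; have vy := small_nadj sv sy.
have xyN := small_nadj sx sy.
have ux : adj u x = false by rewrite (far_ab u v) // eq_sym.
have uy : adj u y = false by rewrite (far_ab u v) // eq_sym.
have ay : adj a y = false by rewrite (far_ab a x).
have bx : adj b x = false by rewrite (far_ab b y) // eq_sym.
apply: (@reducible_absurd (config_spider (adj a b)) v [:: v; u; a; b; x; y]).
- exact: spider_reducible.
- exact: mem_head.
split.
- rewrite /= !inE !negb_or ![v == _]eq_sym xv yv ab xy (adj_neq uv).
  by rewrite (adj_neq ua) (adj_neq ub) (adj_neq ax) (adj_neq b_y) !neq.
- by case: (adj a b).
- by apply/allP; rewrite /= vW uW aW bW xW yW.
- by case=> [|[|[|[|[|[|i]]]]]] [|[|[|[|[|[|j]]]]]] //= _ _ _;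
    rewrite /config_spider; case: ifP.
- by case=> [|[|[|[|[|[|i]]]]]] //= _; rewrite /config_spider;
    case: ifP => /= _; rewrite ?small_deg ?deg_le3.
rewrite /config_spider; case: ifP => // _.
case=> [|[|[|[|[|[|i]]]]]] [|[|[|[|[|[|j]]]]]] q //= _ _ _ _ _ qW _ h1 h2.
all: by rewrite (far_ab q _ _ _ _ _ qW h1) // eq_sym in h2.
Qed.

(** * Counting edges between small vertices and the others *)

Lemma double_count (A B : {set G}) a b :
  (forall x, x \in A -> a <= #|nbrs B x|) ->
  (forall y, y \in B -> #|nbrs A y| <= b) -> a * #|A| <= b * #|B|.
Proof.
move=> lowA upB; rewrite ![_ * #|_|]mulnC -!sum_nat_const.
apply: leq_trans (leq_sum _ upB); apply: leq_trans (leq_sum _ lowA) _.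
have nbrsE C x : #|nbrs C x| = \sum_(y in C) adj x y.
  by rewrite -sum1dep_card big_mkcondr; apply: eq_bigr => y _; case: (adj x y).
under eq_bigr do rewrite nbrsE; under [leqRHS]eq_bigr do rewrite nbrsE.
rewrite exchange_big; apply: eq_leq; apply: eq_bigr => y _.
by apply: eq_bigr => x _; rewrite adj_sym.
Qed.

(** For the set S of small vertices, the set T of the others with a small
    neighbour and the remaining set F, counting edges gives
    2 |S| <= |T| <= 3 |F|. *)
Lemma dense_uncolorable : 30 * #|W| <= 11 * \sum_(x in W) #|nbrs W x|.
Proof.
pose S := [set x in W | #|nbrs W x| <= 2].
pose T := [set x in W :\: S | nbrs S x != set0].
pose F := [set x in W :\: S | nbrs S x == set0].
have inS x : x \in S = small x by rewrite inE.
have SW : S \subset W by apply/subsetP=> x; rewrite inS => /small_in.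
have leST : 2 * #|S| <= 1 * #|T|.
  apply: double_count => [x xS|y].
    have sx : small x by rewrite -inS.
    suff <- : nbrs W x = nbrs T x by rewrite min_degree ?small_in.
    apply/setP=> y; rewrite !in_nbrs; have [xy|] := boolP (adj x y); last first.
      by rewrite !andbF.
    rewrite !andbT; apply/idP/idP=> [yW|]; last first.
      by rewrite !inE => /andP[/andP[_ ->]].
    rewrite in_set in_setD inS yW andbT; apply/andP; split.
      by apply: contraTN xy => sy; rewrite small_nadj.
    by apply/set0Pn; exists x; rewrite in_nbrs xS adj_sym.
  rewrite in_set in_setD => /andP[/andP[_ yW] _].
  apply/card_le1_eqP=> a b; rewrite !in_nbrs !inS => /andP[sa ya] /andP[sb yb].
  exact: (small_common yW).
have leTF : 1 * #|T| <= 3 * #|F|.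
  apply: double_count => [u uT|y _]; last first.
    apply: leq_trans (subcubicG y); apply/subset_leq_card/subsetP=> z.
    by rewrite !inE => /andP[].
  move: uT; rewrite in_set in_setD inS => /andP[/andP[uN uW] /set0Pn[v]].
  rewrite in_nbrs inS => /andP[sv uv].
  have degu : 2 < #|nbrs W u| by move: uN; rewrite /small uW -ltnNge.
  have : 1 < #|nbrs W u :\ v|.
    by move: degu; rewrite (cardsD1 v) in_nbrs uv small_in.
  case/card_gt1P=> a [b [+ + ab]]; rewrite !in_setD1 !in_nbrs.
  move=> /and3P[av aW ua] /and3P[bv bW ub]; rewrite lt0n; apply/negP=> /eqP F0.
  have inT z : z != v -> z \in W -> adj u z -> exists2 x, small x & adj z x.
    move=> zv zW uz; have := cards0_eq F0 => /setP/(_ z).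
    rewrite in_nbrs uz andbT in_set in_setD zW inS in_set0 andbT.
    have -> : ~~ small z.
      by apply: contraNN zv => sz; rewrite (small_common uW sz sv uz uv).
    by move/negbT/set0Pn=> [x]; rewrite in_nbrs inS => /andP[]; exists x.
  have [x sx ax] := inT a av aW ua; have [y sy b_y] := inT b bv bW ub.
  by rewrite (spider_small sv sx sy uW aW bW) ?eqxx in ab.
have cardW : #|W| = #|S| + (#|T| + #|F|).
  rewrite -(cardsID S W) (setIidPr SW) -(cardsID T (W :\: S)) (setIidPr _).
    congr (_ + (_ + #|pred_of_set _|)); apply/setP=> x; rewrite !in_set.
    by case: (nbrs S x == set0) (x \in W) (_ <= 2) => [] [] [].
  by apply/subsetP=> x; rewrite inE => /andP[].
have degS : 2 * #|S| + 3 * (#|T| + #|F|) <= \sum_(x in W) #|nbrs W x|.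
  have cardD : #|W :\: S| = #|T| + #|F|.
    by apply/eqP; rewrite -(eqn_add2l #|S|) -cardW -(cardsID S W) (setIidPr SW).
  rewrite (big_setID S) /= (setIidPr SW) -cardD.
  rewrite (mulnC 2) (mulnC 3) -!sum_nat_const.
  apply: leq_add; apply: leq_sum => x.
    by rewrite inS => /small_in; apply: min_degree.
  by rewrite in_setD inS => /andP[+ xW]; rewrite /small xW -ltnNge.
lia.
Qed.

End Minimal.

Lemma sparse_colorable W :
  (forall U : {set G}, U != set0 ->
     11 * (\sum_(x in U) #|nbrs U x|) < 30 * #|U|) -> colorable W.
Proof.
move=> sparse; have [m] := ubnP #|W|; elim: m W => // m IHm W ltWm.
have [->|W0] := eqVneq W set0.
  apply/existsP; exists [ffun=> (false, false)].
  by apply/goodP; split=> x y; rewrite inE.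
apply: contraT => uncolW.
have := sparse W W0; rewrite ltnNge dense_uncolorable // => U UW.
by apply: IHm; apply: leq_trans (proper_card UW) _.
Qed.

End Colorings.

(** * The bound on the maximum average degree *)

(** The edges inside U form one of the subgraphs over which mad is a maximum, and
    they are counted by the handshake lemma. *)
Lemma mad_sparse (G : sgraph) (U : {set G}) : U != set0 ->
  (mad G < 30%:R / 11%:R)%R ->
  11 * (\sum_(x in U) #|nbrs U x|) < 30 * #|U|.
Proof.
move=> U0 madG; pose F := [set f in edges G | f \subset U].
have leF : \sum_(x in U) #|nbrs U x| <= 2 * #|F|.
  have degF x : x \in U -> #|nbrs U x| <= \sum_(f in F) (x \in f).
    move=> xU; have -> : \sum_(f in F) (x \in f) = #|[set f in F | x \in f]|.
      rewrite -sum1dep_card big_mkcondr; apply: eq_bigr => f _.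
      by case: (x \in f).
    have inj : {in nbrs U x &, injective (fun y => [set x; y])}.
      move=> y z; rewrite !in_nbrs => /andP[_ xy] /andP[_ xz] /setP/(_ y).
      rewrite !inE eqxx orbT; case/esym/orP=> /eqP // yx.
      by rewrite yx adj_irr in xy.
    rewrite -(card_in_imset inj); apply/subset_leq_card/subsetP=> f.
    case/imsetP=> y; rewrite in_nbrs => /andP[yU xy] ->.
    rewrite !inE eqxx andbT; apply/andP; split.
      by apply/existsP; exists x; apply/existsP; exists y; rewrite xy eqxx.
    by apply/subsetP=> z; rewrite !inE => /orP[]/eqP->.
  apply: leq_trans (leq_sum _ degF) _.
  rewrite exchange_big /= mulnC -sum_nat_const.
  apply: leq_sum => f; rewrite inE => /andP[fE _].
  apply: (@leq_trans #|f|).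
    rewrite big_mkcond -sum1_card [leqRHS]big_mkcond /=; apply: leq_sum => x _.
    by case: (x \in U); case: (x \in f).
  move: fE; rewrite inE => /existsP[x /existsP[y /andP[_ /eqP->]]].
  by rewrite cards2; case: (_ != _).
have : (2 * #|F|%:R / #|U|%:R <= mad G)%R.
  rewrite /mad; apply: (@le_bigmax_cond _ _ _ _ (U, F) _
    (fun H => 2 * #|H.2|%:R / #|H.1|%:R)%R).
  rewrite U0 andbT; apply/andP; split.
    by apply/subsetP=> f; rewrite inE => /andP[].
  by apply/forall_inP=> f; rewrite inE => /andP[].
move/le_lt_trans/(_ madG).
have Upos : (0 < #|U|%:R :> rat)%R by rewrite ltr0n card_gt0.
rewrite ltr_pdivrMr // mulrAC ltr_pdivlMr ?ltr0n //.
rewrite -!natrM ltr_nat => lt30; lia.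
Qed.

(** * From good colourings to packing colourings of the subdivision *)

Lemma dist_geq_walk (G : sgraph) (x y : G) d :
  (forall n, walk x y n -> d <= n) -> dist_geq x y d.
Proof.
rewrite /dist_geq /dist => dP; case: {-}_ / idP => // xy.
by case: ex_minnP => n /dP.
Qed.

Lemma subdivision_step (G : sgraph) (x y : G) (f : {f | f \in edges G}) :
  x \in val f -> y \in val f -> x = y \/ adj x y.
Proof.
case: f => f /=; rewrite inE => /existsP[a /existsP[b /andP[ab /eqP->]]].
by rewrite !inE => /orP[]/eqP-> /orP[]/eqP->; rewrite 1?[adj b a]adj_sym; auto.
Qed.

Lemma subdivision_walk (G : sgraph) (x y : G) n : x != y ->
  @walk (subdivision G) (inl x) (inl y) n ->
  [\/ n = 2 /\ adj x y,
      n = 4 /\ (adj x y \/ exists2 z, adj z x & adj z y) | 6 <= n].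
Proof.
move=> xy /existsP[[s /= /eqP <-]] /andP[].
case: s => [|[?|f] [|[z|?] [|[?|g] [|[t|?] [|[?|h] [|u s]]]]]] //=;
  rewrite ?andbF ?andbT //.
- by move=> _ /eqP[xy']; rewrite xy' eqxx in xy.
- move=> /andP[xf zf] /eqP[zy]; constructor 1; split=> //.
  rewrite -zy in xy *; case: (subdivision_step xf zf) xy => // ->.
  by rewrite eqxx.
- move=> /and4P[xf zf zg tg] /eqP[ty]; constructor 2; split=> //.
  rewrite -ty in xy *.
  have [xz|xz] := subdivision_step xf zf;
    have [zt|zt] := subdivision_step zg tg.
  - by rewrite xz zt eqxx in xy.
  - by left; rewrite xz.
  - by left; rewrite -zt.
  - by right; exists z; rewrite // adj_sym.
by constructor 3.
Qed.

(** Packing colours are counted from 0: value i stands for colour i + 1. *)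
Definition packing_color (G : sgraph) (c : G -> color) (u : subdivision G) :=
  if u is inl x then (c x).1.*2 + (c x).2 + 1 else 0.

Lemma packing_color_lt (G : sgraph) (c : G -> color) (u : subdivision G) :
  packing_color c u < 5.
Proof. by case: u => [x|f] //=; case: (c x) => [[] []]. Qed.

Lemma packing_color_inl (G : sgraph) (c : G -> color) (x y : G) :
  packing_color c (inl x) = packing_color c (inl y) -> c x = c y.
Proof. by rewrite /packing_color; case: (c x) (c y) => [[] []] [[] []]. Qed.

(** Distances between vertices of G are even in the subdivision, so colours 2
    and 3 only exclude adjacent vertices of G, and colours 4 and 5 only exclude
    vertices at distance at most two. *)
Lemma colorable_packing (G : sgraph) :
  colorable [set: G] -> packing_colorable (subdivision G) (iota 1 5).
Proof.
case/existsP=> c /goodP[edg chr].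
apply/existsP; exists [ffun u => Ordinal (packing_color_lt c u)].
apply/forallP=> u; apply/forallP=> w; apply/implyP; rewrite !ffunE.
move=> /andP[uw /eqP[cuw]]; apply: dist_geq_walk => n.
rewrite /= -/(iota 1 5) nth_iota ?packing_color_lt // add1n.
case: u w uw cuw => [x|f] [y|g] uw cuw wlk.
- have xy : x != y by apply: contraNneq uw => ->.
  have cxy := packing_color_inl cuw.
  have xyN : ~ adj x y.
    by move/(edg x y (in_setT _) (in_setT _)); rewrite cxy eqxx.
  have [[_ //]|[n4 [//|[z zx zy]]]|n6] := subdivision_walk xy wlk; last first.
    (* The largest colour needs distance 6. *)
    by apply: leq_trans n6; have := packing_color_lt c (inl x).
  have := chr x z y (in_setT _) (in_setT _) (in_setT _) zx zy xy.
  by rewrite /compatible cxy eqxx andbT n4 /= cxy; case: (c y) => [[] []].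
- by move: cuw => /=; rewrite addn1.
- by move: cuw => /=; rewrite addn1.
case: n wlk => [|[|//]] /existsP[[[|a [|b s]]] //= ?].
- by case/eqP=> fg; rewrite fg eqxx in uw.
- by case: a => //= x; rewrite !andbF.
Qed.

Theorem corollary1p5 (G : sgraph) (G_subcubic : subcubic G)
    (G_mad : (mad G < 30%:R / 11%:R)%R) :
  packing_chromatic (subdivision G) <= 5.
Proof.
rewrite /packing_chromatic; case: ex_minnP => m _; apply.
apply/colorable_packing/sparse_colorable => [x|U U0].
  by apply: leq_trans G_subcubic; apply: (@leq_bigmax _ (@degree G)).
exact: mad_sparse.
Qed.
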